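(* Let $\mathbb{I}=(I,\le,\mathcal{I})$ be a set of indices, let $\mathcal{J}\subseteq\mathcal{I}$ be a nonempty subset such that for all $A,B\in\mathcal{J}$ there is $C\in\mathcal{J}$ with $C\subseteq A\cap B$, and let $(x_\varepsilon),(y_\varepsilon),(z_\varepsilon)\in\mathbb{R}^I$ be nets of real numbers. Then, as $\varepsilon\in\mathbb{I}$: (i) $x_\varepsilon=O_{\mathcal{J}}(x_\varepsilon)$; (ii) if $x_\varepsilon=O_{\mathcal{J}}(y_\varepsilon)$ and $y_\varepsilon=O_{\mathcal{J}}(z_\varepsilon)$, then $x_\varepsilon=O_{\mathcal{J}}(z_\varepsilon)$; (iii) $O_{\mathcal{J}}(x_\varepsilon)\cdot O_{\mathcal{J}}(y_\varepsilon)=O_{\mathcal{J}}(x_\varepsilon\cdot y_\varepsilon)$; (iv) $O_{\mathcal{J}}(x_\varepsilon)+O_{\mathcal{J}}(y_\varepsilon)=O_{\mathcal{J}}(|x_\varepsilon|+|y_\varepsilon|)$; (v) $x_\varepsilon\cdot O_{\mathcal{J}}(y_\varepsilon)=O_{\mathcal{J}}(x_\varepsilon\cdot y_\varepsilon)$; (vi) $O_{\mathcal{J}}(x_\varepsilon)+O_{\mathcal{J}}(x_\varepsilon)=O_{\mathcal{J}}(x_\varepsilon)$; (vii) if $x_\varepsilon,y_\varepsilon\ge 0$ for all $\varepsilon\in I$, then $x_\varepsilon+O_{\mathcal{J}}(y_\varepsilon)=O_{\mathcal{J}}(x_\varepsilon+y_\varepsilon)$; (viii) for all $k\in\mathbb{R}$: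 $O_{\mathcal{J}}(k\cdot x_\varepsilon)=O_{\mathcal{J}}(x_\varepsilon)$; (ix) for all $k\in\mathbb{R}$: $k\cdot O_{\mathcal{J}}(x_\varepsilon)=O_{\mathcal{J}}(x_\varepsilon)$.
   Context: A set of indices is a triple $\mathbb{I}=(I,\le,\mathcal{I})$ such that: (1) $I$ is a nonempty set and $\le$ is a reflexive and transitive relation on $I$; (2) $\mathcal{I}$ is a set of subsets of $I$ with $\emptyset\notin\mathcal{I}$ and $I\in\mathcal{I}$; (3) for all $A,B\in\mathcal{I}$ there is $C\in\mathcal{I}$ with $C\subseteq A\cap B$; (4) writing $(\emptyset,e]:=\{\varepsilon\in I\mid\varepsilon\le e\}$, $A_{\le e}:=(\emptyset,e]\cap A$, and $\varepsilon<e$ for ''$\varepsilon\le e$ and $\varepsilon\neq e$'': whenever $e\le a\in A\in\mathcal{I}$, the set $A_{\le e}$ is nonempty and for all $b,c\in A_{\le e}$ there is $d\in A_{\le e}$ with $d<b$ and $d<c$. (It is not required that $e\in A$.) For $a\in A\in\mathcal{I}$, one writes $x_\varepsilon=O_{a,A}(y_\varepsilon)$ if there exist $H\in\mathbb{R}_{>0}$ and $\varepsilon_0\in A_{\le a}$ such that $|x_\varepsilon|\le H\cdot|y_\varepsilon|$ for all $\varepsilon\in A_{\le\varepsilon_0}$. One writes $x_\varepsilon=O_{\mathcal{J}}(y_\varepsilon)$ as $\varepsilon\in\mathbb{I}$ if there exists $A\in\mathcal{J}$ such that for all $a\in A$: $x_\varepsilon=O_{a,A}(y_\varepsilon)$.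 Equalities between big-O expressions are read from left to right: e.g. (iii) means that if $x'_\varepsilon=O_{\mathcal{J}}(x_\varepsilon)$ and $y'_\varepsilon=O_{\mathcal{J}}(y_\varepsilon)$ then $x'_\varepsilon y'_\varepsilon=O_{\mathcal{J}}(x_\varepsilon y_\varepsilon)$; (viii) means that $x'_\varepsilon=O_{\mathcal{J}}(kx_\varepsilon)$ implies $x'_\varepsilon=O_{\mathcal{J}}(x_\varepsilon)$; and similarly for the others. *)

(* Defs.v *)
From mathcomp Require Import all_boot all_order all_algebra.
From mathcomp Require Import classical_sets reals.
Set Implicit Arguments.
Unset Strict Implicit.
Unset Printing Implicit Defensive.
Import Order.TTheory GRing.Theory Num.Theory.
Local Open Scope classical_set_scope.
Local Open Scope ring_scope.

(* A_{<= e} = (0, e] `&` A, where e is not required to belong to A. *)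
Definition downset (I : Type) (le : I -> I -> Prop) (A : set I) (e : I) :
    set I := [set eps | le eps e] `&` A.

(* The relation le is only a preorder, so this is not the usual strict part
   (le eps e and not le e eps) of le. *)
Definition strictly_below (I : Type) (le : I -> I -> Prop) (eps e : I) : Prop :=
  le eps e /\ eps <> e.

Record indexSet := IndexSet {
  idx :> Type ;
  ile : idx -> idx -> Prop ;
  idx_family : set (set idx) ;
  idx_nonempty : [set: idx] !=set0 ;
  ile_refl : forall e, ile e e ;
  ile_trans : forall e1 e2 e3, ile e1 e2 -> ile e2 e3 -> ile e1 e3 ;
  idx_family_not_set0 : ~ idx_family set0 ;
  idx_family_setT : idx_family [set: idx] ;
  idx_family_cap : forall A B, idx_family A -> idx_family B ->
    exists2 C, idx_family C & C `<=` A `&` B ;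
  downset_nonempty : forall A a e, idx_family A -> A a -> ile e a ->
    downset ile A e !=set0 ;
  downset_directed : forall A a e, idx_family A -> A a -> ile e a ->
    forall b c, downset ile A e b -> downset ile A e c ->
    exists2 d, downset ile A e d &
      strictly_below ile d b /\ strictly_below ile d c
}.

(* bigO_at a A x y stands for x_eps = O_{a,A}(y_eps), and bigO J x y for
   x_eps = O_J(y_eps); A is chosen before a, while H and eps0 depend on a. *)
Definition bigO_at (R : realType) (I : indexSet) (a : I) (A : set I)
    (x y : I -> R) : Prop :=
  exists H : R, 0 < H /\
  exists2 eps0 : I, downset (@ile I) A a eps0 &
    forall eps : I, downset (@ile I) A eps0 eps -> `|x eps| <= H * `|y eps|.

Definition bigO (R : realType) (I : indexSet) (J : set (set I))
    (x y : I -> R) : Prop :=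
  exists2 A : set I, J A & forall a : I, A a -> bigO_at a A x y.

(* Main.v *)
Require Import Defs.
From mathcomp Require Import all_boot all_order all_algebra.
From mathcomp Require Import classical_sets reals.
Import Order.TTheory GRing.Theory Num.Theory.
Local Open Scope classical_set_scope.
Local Open Scope ring_scope.

(** Two big-O hypotheses over [J] come with their own sets [A] and [B] of [J],
    and, for each [a], their own thresholds [e1] in [A] and [e2] in [B], with
    [e1] and [e2] below [a]. Everything rests on finding a common set [C] and a
    common threshold ([bigO_map2]). Take [C] in [J] included in [A] and [B],
    and [a] in [C]. The threshold [e1] need not lie in [C], but it is below the
    element [a] of [C], so that some element of [C] is below [e1]; likewise for
    [e2]. Directedness of the part of [C] below [a] then yields one element of
    [C] below both thresholds, under which both estimates hold at once.

    Transitivity (ii), products (iii) and sums (iv) are thereby reduced to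
    elementary inequalities between real numbers. The other properties follow
    from these three, combined with big-O estimates that hold at every index
    ([bigO_pointwise]): [x = O(x)], [k * x = O(x)], [|x| + |x| = O(x)], and
    [|x| + |y| = O(x + y)] for nonnegative [x] and [y]. *)

Lemma common_threshold {I : indexSet} {C : set I} {a e1 e2 : I} :
  idx_family C -> C a -> ile e1 a -> ile e2 a ->
  exists2 d, downset (@ile I) C a d & ile d e1 /\ ile d e2.
Proof.
move=> IC Ca e1a e2a.
have [c1 [c1e1 Cc1]] := downset_nonempty IC Ca e1a.
have [c2 [c2e2 Cc2]] := downset_nonempty IC Ca e2a.
have c1a : downset (@ile I) C a c1 by split=> //; exact: ile_trans c1e1 e1a.
have c2a : downset (@ile I) C a c2 by split=> //; exact: ile_trans c2e2 e2a.
have [d da [[dc1 _] [dc2 _]]] := downset_directed IC Ca (ile_refl a) c1a c2a.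
by exists d => //; split; [exact: ile_trans dc1 c1e1|exact: ile_trans dc2 c2e2].
Qed.

Lemma bigO_pointwise {R : realType} {I : indexSet} {J : set (set I)}
    (H : R) {x y : I -> R} :
  J !=set0 -> 0 < H -> (forall e, `|x e| <= H * `|y e|) -> bigO J x y.
Proof.
move=> [A JA] H0 xy; exists A => // a Aa; exists H; split=> //.
by exists a => //; split=> //; exact: ile_refl.
Qed.

Section BigO.
Context {R : realType} {I : indexSet} {J : set (set I)}.
Hypothesis J_sub : J `<=` @idx_family I.
Hypothesis J_cap : forall A B : set I, J A -> J B ->
  exists2 C : set I, J C & C `<=` A `&` B.
Implicit Types x y z w : I -> R.

(** Two big-O estimates can be combined into a third as soon as they can be
    combined at each index, with a constant depending only on the two given
    constants. *)
Lemma bigO_map2 {x x' y y' w w'} :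
  (forall H K : R, 0 < H -> 0 < K -> exists2 L : R, 0 < L &
     forall e, `|x' e| <= H * `|x e| -> `|y' e| <= K * `|y e| ->
       `|w' e| <= L * `|w e|) ->
  bigO J x' x -> bigO J y' y -> bigO J w' w.
Proof.
move=> comb [A JA xA] [B JB yB].
have [C JC CAB] := J_cap _ _ JA JB.
exists C => // a Ca; have [Aa Ba] := CAB _ Ca.
have [H [H0 [e1 [e1a _] xH]]] := xA _ Aa.
have [K [K0 [e2 [e2a _] yK]]] := yB _ Ba.
have [L L0 wL] := comb H K H0 K0.
have [d da [de1 de2]] := common_threshold (J_sub _ JC) Ca e1a e2a.
exists L; split=> //; exists d => // e [ed Ce]; have [Ae Be] := CAB _ Ce.
apply: wL; [apply: xH|apply: yK]; split=> //.
- exact: ile_trans ed de1.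
- exact: ile_trans ed de2.
Qed.

Lemma bigO_trans {x y z} : bigO J x y -> bigO J y z -> bigO J x z.
Proof.
apply: bigO_map2 => H K H0 K0; exists (H * K); first exact: mulr_gt0.
move=> e xy yz; apply: le_trans xy _.
by rewrite -mulrA ler_pM2l.
Qed.

Lemma bigO_mul {x x' y y'} : bigO J x' x -> bigO J y' y ->
  bigO J (fun e => x' e * y' e) (fun e => x e * y e).
Proof.
apply: bigO_map2 => H K H0 K0; exists (H * K); first exact: mulr_gt0.
by move=> e xx yy; rewrite !normrM mulrACA ler_pM.
Qed.

Lemma bigO_add {x x' y y'} : bigO J x' x -> bigO J y' y ->
  bigO J (fun e => x' e + y' e) (fun e => `|x e| + `|y e|).
Proof.
apply: bigO_map2 => H K H0 K0; exists (H + K); first exact: addr_gt0.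
move=> e xx yy; apply: le_trans (ler_normD _ _) _.
rewrite (ger0_norm (addr_ge0 _ _)) // mulrDr lerD //.
- by apply: le_trans xx _; rewrite ler_wpM2r// lerDl ltW.
- by apply: le_trans yy _; rewrite ler_wpM2r// lerDr ltW.
Qed.

End BigO.

Theorem theorem16 (R : realType) (I : indexSet) (J : set (set I))
    (J_sub : J `<=` @idx_family I) (J_nonempty : J !=set0)
    (J_cap : forall A B : set I, J A -> J B ->
      exists2 C : set I, J C & C `<=` A `&` B)
    (x y z : I -> R) :
  (* (i) *)
  bigO J x x /\
  (* (ii) *)
  (bigO J x y -> bigO J y z -> bigO J x z) /\
  (* (iii) *)
  (forall x' y' : I -> R, bigO J x' x -> bigO J y' y ->
     bigO J (fun eps => x' eps * y' eps) (fun eps => x eps * y eps)) /\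
  (* (iv) *)
  (forall x' y' : I -> R, bigO J x' x -> bigO J y' y ->
     bigO J (fun eps => x' eps + y' eps) (fun eps => `|x eps| + `|y eps|)) /\
  (* (v) *)
  (forall y' : I -> R, bigO J y' y ->
     bigO J (fun eps => x eps * y' eps) (fun eps => x eps * y eps)) /\
  (* (vi) *)
  (forall x' x'' : I -> R, bigO J x' x -> bigO J x'' x ->
     bigO J (fun eps => x' eps + x'' eps) x) /\
  (* (vii) *)
  ((forall eps : I, 0 <= x eps /\ 0 <= y eps) ->
     forall y' : I -> R, bigO J y' y ->
     bigO J (fun eps => x eps + y' eps) (fun eps => x eps + y eps)) /\
  (* (viii) *)
  (forall (k : R) (x' : I -> R), bigO J x' (fun eps => k * x eps) ->
     bigO J x' x) /\
  (* (ix) *)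
  (forall (k : R) (x' : I -> R), bigO J x' x ->
     bigO J (fun eps => k * x' eps) x).
Proof.
have refl (w : I -> R) : bigO J w w.
  by apply: (bigO_pointwise 1) => // e; rewrite mul1r.
have scale (k : R) (w : I -> R) : bigO J (fun e => k * w e) w.
  (* [k] may be zero, whereas the constant must be positive. *)
  apply: (bigO_pointwise (`|k| + 1)) => // [|e].
    by rewrite ltr_wpDl.
  by rewrite normrM ler_wpM2r// lerDl.
split; first exact: refl.
split; first exact: (bigO_trans J_sub J_cap).
split; first by move=> x' y'; exact: (bigO_mul J_sub J_cap).
split; first by move=> x' y'; exact: (bigO_add J_sub J_cap).
split; first by move=> y'; exact: (bigO_mul J_sub J_cap (refl x)).
split.
  move=> x' x'' x'x x''x.
  apply: (bigO_trans J_sub J_cap (bigO_add J_sub J_cap x'x x''x)).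
  apply: (bigO_pointwise 2) => // e.
  by rewrite -mulr2n normrMn normr_id mulr_natl.
split.
  move=> xy0 y' y'y.
  have := bigO_add J_sub J_cap (refl x) y'y.
  move/(bigO_trans J_sub J_cap); apply.
  apply: (bigO_pointwise 1) => // e.
  by have [x0 y0] := xy0 e; rewrite mul1r (ger0_norm x0) (ger0_norm y0).
split=> k x'.
- by move=> x'kx; exact: (bigO_trans J_sub J_cap x'kx (scale k x)).
- by move=> x'x; exact: (bigO_trans J_sub J_cap (scale k x') x'x).
Qed.
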